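(* Let $D$ be an integral domain. The following are equivalent (equalities being equalities of semistar operations on $D$). (i) $b=w$. (ii) $D$ is a Prüfer domain. (iii) $d=b$.
   Context: Let $D$ be an integral domain with quotient field $K$. An overring of $D$ is a ring $T$ with $D\subseteq T\subseteq K$; a valuation overring is an overring which is a valuation domain. Equality of semistar operations means equality as maps on the set of all nonzero $D$-submodules of $K$. For each nonzero $D$-submodule $E$ of $K$: $E^d:=E$; $E^b:=\bigcap\{EV \mid V \text{ valuation overring of } D\}$; $E^v:=(D:(D:E))$, where $(D:E):=\{x\in K\mid xE\subseteq D\}$; $E^t:=\bigcup\{F^v\mid F\subseteq E,\ F\text{ nonzero finitely generated fractional ideal}\}$; $E^w:=\bigcap\{ED_Q\mid Q\in\mathrm{Max}^t(D)\}$ (an empty intersection being $K$), where $\mathrm{Max}^t(D)$ is the set of maximal elements among proper nonzero ideals $I$ of $D$ with $I^t=I$. *)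

(* Defs.v *)
From mathcomp Require Import all_boot all_algebra.
From mathcomp Require Import boolp classical_sets.

Set Implicit Arguments.
Unset Strict Implicit.
Unset Printing Implicit Defensive.

Import GRing.Theory.

Local Open Scope classical_set_scope.
Local Open Scope ring_scope.

Section SemistarOperations.
Variable D : idomainType.
Local Notation K := {fraction D}.
Implicit Types (E F I J M Q T V : set K).

(* D is identified with its image in K; ideals of D, overrings of D and
   D-submodules of K are all subsets of K. *)
Definition base_ring : set K := range (@tofrac D).

Definition submodule E : Prop :=
  zmod_closed (mem E) /\ forall (a : D) x, E x -> E (tofrac a * x).

Definition nonzero_submodule E : Prop := submodule E /\ E != [set 0].

Definition ideal I : Prop := submodule I /\ I `<=` base_ring.

Definition fractional_ideal F : Prop :=
  submodule F /\ exists2 d : D, d != 0 & forall x, F x -> base_ring (tofrac d * x).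

Definition finitely_generated E : Prop :=
  exists (n : nat) (g : 'I_n -> K),
    E = [set x | exists c : 'I_n -> D, x = \sum_i tofrac (c i) * g i].

(* E F is the set of finite sums of products, not of bare products. *)
Definition mul_submodule E F : set K :=
  [set x | exists (n : nat) (e f : 'I_n -> K),
     [/\ forall i, E (e i), forall i, F (f i) & x = \sum_i e i * f i]].

(* (D : E), taken in K *)
Definition colon E : set K := [set x | forall y, E y -> base_ring (x * y)].

Definition overring T : Prop := subring_closed (mem T) /\ base_ring `<=` T.

(* The quotient field of an overring of D is K itself, hence the valuation
   condition ranges over K; K is a valuation overring. *)
Definition valuation_overring V : Prop :=
  overring V /\ forall x : K, x != 0 -> V x \/ V x^-1.

Definition localization Q : set K :=
  [set x | exists a s : D, ~ Q (tofrac s) /\ x = tofrac a / tofrac s].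

Definition semistar_d E : set K := E.

Definition semistar_b E : set K :=
  \bigcap_(V in valuation_overring) mul_submodule E V.

Definition semistar_v E : set K := colon (colon E).

Definition semistar_t E : set K :=
  \bigcup_(F in [set F | [/\ F `<=` E, F != [set 0], finitely_generated F
                           & fractional_ideal F]]) semistar_v F.

Definition proper_t_ideal I : Prop :=
  [/\ ideal I, I != base_ring, I != [set 0] & semistar_t I = I].

Definition t_maximal M : Prop :=
  proper_t_ideal M /\ forall J, proper_t_ideal J -> M `<=` J -> J = M.

Definition semistar_w E : set K :=
  \bigcap_(Q in t_maximal) mul_submodule E (localization Q).

(* A semistar operation only has meaning on nonzero D-submodules of K. *)
Definition semistar_eq (s1 s2 : set K -> set K) : Prop :=
  forall E, nonzero_submodule E -> s1 E = s2 E.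

Definition invertible_ideal I : Prop := mul_submodule I (colon I) = base_ring.

Definition Prufer_domain : Prop :=
  forall I, ideal I -> I != [set 0] -> finitely_generated I -> invertible_ideal I.

End SemistarOperations.

Arguments base_ring : clear implicits.
Arguments semistar_d : clear implicits.
Arguments semistar_b : clear implicits.
Arguments semistar_v : clear implicits.
Arguments semistar_t : clear implicits.
Arguments semistar_w : clear implicits.

(* Main.v *)
Require Import Defs.
From mathcomp Require Import all_boot all_algebra.
From mathcomp Require Import boolp classical_sets.
From mathcomp Require Import ring.

(** Two facts carry the equivalence.

    First, a valuation overring lies over every proper ideal [J]: some
    valuation overring [V] has [1] outside [J V] ([valuation_above]).  Hence
    [1] is not in the b-closure of [J].

    Second, [x] is always in the b-closure of [D + D x^2] ([mem_quad_b]):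
    write [x = 1 * x] if [x] is in [V], and [x = x^2 * x^-1] otherwise.  If
    this membership survives in the localization [D_Q] at a prime [Q], it says
    that [s x = u + v x^2] with [s] outside [Q].  Then [v x] is integral over
    [D], and once [D_Q] is b-closed, [v x] lies in [D_Q].  From
    [v x (s - v x) = u v] and the locality of [D_Q] it follows that [x] or
    [x^-1] is in [D_Q], so that [D_Q] is a valuation ring
    ([localization_valuation]).

    Suppose [b = w], and let [F] be a nonzero finitely generated ideal with
    [J = F (D : F)] proper.  As [1] is not in [J^b = J^w], a t-maximal [Q]
    contains [J].  It is prime ([t_maximal_prime]), and both hypotheses of the
    second fact transfer from [b] to [w], where they are plain statements
    about [D_Q].  In the valuation ring [D_Q] the ideal [F] is principal, which
    puts an element outside [Q] into [J]: a contradiction, so [F] is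
    invertible.  If [d = b], the same argument applies with a maximal ideal
    over [J] in place of [Q].

    Suppose [D] is Prufer and [x] is in [E^b].  Let [I] be the ideal of those
    [d] in [D] with [d x] in [E].  If [I] were proper, take [V] with [1]
    outside [I V] and write [x] as the sum of the [e_i f_i], with [e_i] in [E]
    and [f_i] in [V].  The fractional ideal generated by [1] and the [f_i] is
    contained in [V], and its inverse is contained in [I]; being invertible, it
    gives [1] in [I V].  So [I] contains [1] and [x] is in [E], whence [d = b].

    Finally, in a Prufer domain every nonzero ideal is a t-ideal, because
    invertible ideals are divisorial ([Prufer_t_ideal]).  So maximal ideals
    containing a nonzero ideal are t-maximal, and the [w]-closure is an
    intersection over enough localizations to be the identity
    ([w_of_Prufer]).  Together with [d = b] this gives [b = w]. *)

Set Implicit Arguments.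
Unset Strict Implicit.
Unset Printing Implicit Defensive.

Import GRing.Theory.

Local Open Scope quotient_scope.
Local Open Scope classical_set_scope.
Local Open Scope ring_scope.

(** * Zorn's lemma for families of sets *)

Lemma Zorn_above (T : Type) (C : set (set T)) (A0 : set T) :
  C A0 ->
  (forall F : set (set T), F !=set0 -> F `<=` C -> total_on F subset ->
     C (\bigcup_(X in F) X)) ->
  exists A, [/\ C A, A0 `<=` A & forall B, C B -> A `<=` B -> B = A].
Proof.
move=> CA0 Cchain.
(* Zorn_bigcup asks P of the union of every chain; for the empty chain this
   union is empty, hence the first disjunct. *)
pose P (A : set T) := A = set0 \/ C A /\ A0 `<=` A.
have [|A [PA Amax]] := @Zorn_bigcup T P.
  move=> F FP Ftot; case: (pselect (exists2 X, F X & X != set0)); last first.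
    move=> F0; left; apply/seteqP; split=> x //= -[X FX Xx].
    by case: F0; exists X => //; apply/set0P; exists x.
  move=> [X0 FX0 X00]; right.
  pose G := [set X | F X /\ X != set0].
  have GC : forall X, G X -> C X /\ A0 `<=` X.
    by move=> X [/FP[->|//]]; rewrite eqxx.
  have -> : \bigcup_(X in F) X = \bigcup_(X in G) X.
    apply/seteqP; split=> x [X FX Xx]; exists X => //; last by case: FX.
    by split=> //; apply/set0P; exists x.
  split; last by move=> x A0x; exists X0 => //; apply: (GC _ _).2.
  apply: Cchain; first by exists X0.
    by move=> X /GC[].
  by move=> X Y [FX _] [FY _]; apply: Ftot.
have maxA B : C B -> A0 `<=` B -> A `<=` B -> B = A.
  move=> CB A0B AB; apply: contrapT => BA; apply: (Amax B); last by right.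
  by split=> // BA'; apply: BA; apply/seteqP.
case: PA => [A0' | [CA A0A]].
  have A00 : A0 = set0 by rewrite -A0'; apply: maxA => //; rewrite A0'.
  exists A; rewrite A0' -A00; split=> // B CB A0B.
  by rewrite A00 -A0'; apply: maxA; rewrite ?A0' ?A00.
by exists A; split=> // B CB AB; apply: maxA => //; apply: subset_trans AB.
Qed.

Lemma finite_family_in_chain (T : Type) (F : set (set T)) (n : nat)
    (x : 'I_n -> T) :
  F !=set0 -> total_on F subset ->
  (forall i, (\bigcup_(X in F) X) (x i)) ->
  exists2 X, F X & forall i, X (x i).
Proof.
move=> F0 Ftot; elim: n x => [x _|n IHn x Fx].
  by case: F0 => X FX; exists X => // -[].
have [i|X FX Xx] := IHn (fun i => x (lift ord0 i)); first exact: Fx.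
have [Y FY Yx] := Fx ord0.
have [XY|YX] := Ftot _ _ FX FY.
  by exists Y => // i; case: (unliftP ord0 i) => [j|] ->; [apply: XY|].
by exists X => // i; case: (unliftP ord0 i) => [j|] ->; [|apply: YX].
Qed.

Section Prufer.
Variable D : idomainType.
Local Notation K := {fraction D}.
Local Notation "x %:F" := (@tofrac D x).
Implicit Types (E F I J M Q T V : set K).

(** * Submodules, overrings and products *)

Lemma submoduleP E :
  submodule E <->
  [/\ E 0, forall x y, E x -> E y -> E (x - y)
    & forall (a : D) x, E x -> E (a%:F * x)].
Proof.
split=> [[[E0 EB] EZ]|[E0 EB EZ]].
  split=> //; first exact/set_mem.
  by move=> x y Ex Ey; apply/set_mem/EB; apply/mem_set.
split=> //; split; first exact/mem_set.
by move=> x y /set_mem Ex /set_mem Ey; apply/mem_set/EB.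
Qed.

Section Submodule.
Variable E : set K.
Hypothesis subE : submodule E.

Lemma submodule0 : E 0. Proof. by case/submoduleP: subE. Qed.

Lemma submoduleB x y : E x -> E y -> E (x - y).
Proof. by case/submoduleP: subE => _ EB _; apply: EB. Qed.

Lemma submoduleZ (a : D) x : E x -> E (a%:F * x).
Proof. by case/submoduleP: subE => _ _; apply. Qed.

Lemma submoduleN x : E x -> E (- x).
Proof. by move=> Ex; rewrite -sub0r; apply/submoduleB/Ex/submodule0. Qed.

Lemma submoduleD x y : E x -> E y -> E (x + y).
Proof.
by move=> Ex Ey; rewrite -[y]opprK; apply/submoduleB/submoduleN/Ey.
Qed.

Lemma submodule_sum (I : Type) (r : seq I) (P : pred I) (f : I -> K) :
  (forall i, P i -> E (f i)) -> E (\sum_(i <- r | P i) f i).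
Proof.
by move=> Ef; apply: big_ind Ef; [apply: submodule0|apply: submoduleD].
Qed.

End Submodule.

Lemma overringP T :
  overring T <->
  [/\ forall a, T a%:F, forall x y, T x -> T y -> T (x - y)
    & forall x y, T x -> T y -> T (x * y)].
Proof.
split=> [[[T1 TB TM] DT]|[TD TB TM]].
  split=> [a|x y Tx Ty|x y Tx Ty]; first by apply: DT; exists a.
    by apply/set_mem/TB; apply/mem_set.
  by apply/set_mem/TM; apply/mem_set.
split; last by move=> _ [a _ <-].
split=> [|x y|x y]; first by apply/mem_set; rewrite -tofrac1.
  by move=> /set_mem Tx /set_mem Ty; apply/mem_set/TB.
by move=> /set_mem Tx /set_mem Ty; apply/mem_set/TM.
Qed.

Lemma overring_base T a : overring T -> T a%:F.
Proof. by case/overringP. Qed.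

Lemma overring1 T : overring T -> T 1.
Proof. by rewrite -tofrac1; apply: overring_base. Qed.

Lemma overringM T x y : overring T -> T x -> T y -> T (x * y).
Proof. by case/overringP => _ _; apply. Qed.

Lemma overring_submodule T : overring T -> submodule T.
Proof.
case/overringP=> TD TB TM; apply/submoduleP; split=> //.
  by rewrite -tofrac0.
by move=> a x Tx; apply: TM.
Qed.

Lemma base_overring : overring (base_ring D).
Proof.
apply/overringP; split=> [a|_ _ [a _ <-] [b _ <-]|_ _ [a _ <-] [b _ <-]].
- by exists a.
- by exists (a - b); rewrite ?tofracB.
- by exists (a * b); rewrite ?tofracM.
Qed.

Lemma idealN1P I : ideal I -> I != base_ring D <-> ~ I 1.
Proof.
move=> [subI ID]; split=> [/eqP IneD I1|I1]; last first.
  by apply/eqP=> ID'; apply: I1; rewrite ID'; apply: overring1 base_overring.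
apply: IneD; apply/seteqP; split=> // _ [a _ <-].
by rewrite -[a%:F]mulr1; apply: submoduleZ.
Qed.

Lemma submodule_neq0 E x : E x -> x != 0 -> E != [set 0].
Proof.
by move=> Ex x0; apply/eqP=> E0; move: Ex x0; rewrite E0 => ->; rewrite eqxx.
Qed.

Lemma submodule_neq0P E :
  submodule E -> E != [set 0] -> exists2 x, E x & x != 0.
Proof.
move=> subE /eqP E0; apply: contrapT => Ex; apply: E0.
apply/seteqP; split=> [x Exx|_ ->]; last exact: submodule0.
by apply: contrapT => /eqP x0; apply: Ex; exists x.
Qed.

Lemma fracP (x : K) : exists a b : D, b != 0 /\ x = a%:F / b%:F.
Proof.
elim/quotW: x => x; exists \n_x, \d_x; split; first exact: denom_ratioP.
have d0 : (\d_x)%:F != 0 :> {fraction D} by rewrite tofrac_eq0 denom_ratioP.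
apply: (mulIf d0); rewrite divfK //.
rewrite -[LHS]/(FracField.mul (\pi x) (\d_x)%:F) !piE.
apply/eqmodP => /=; rewrite FracField.equivfE /FracField.mulf.
rewrite !numden_Ratio ?mulf_neq0 ?denom_ratioP ?oner_neq0 //.
by rewrite !mulr1 mulrC.
Qed.

Lemma mul_submodule_mul E F e f : E e -> F f -> mul_submodule E F (e * f).
Proof.
by move=> Ee Ff; exists 1%N, (fun=> e), (fun=> f); rewrite big_ord1.
Qed.

Lemma mul_submodule_ind (P : K -> Prop) E F :
  P 0 -> (forall x y, P x -> P y -> P (x + y)) ->
  (forall e f, E e -> F f -> P (e * f)) ->
  forall x, mul_submodule E F x -> P x.
Proof.
move=> P0 PD PM _ [n [e [f [Ee Ff ->]]]].
by apply: big_ind => // i _; apply: PM.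
Qed.

Lemma mul_submodule_sub E F G :
  submodule G -> (forall e f, E e -> F f -> G (e * f)) ->
  mul_submodule E F `<=` G.
Proof.
move=> subG EFG x; apply: mul_submodule_ind => //; first exact: submodule0.
exact: submoduleD.
Qed.

Lemma mul_submodule_is_submodule E F :
  submodule E -> submodule (mul_submodule E F).
Proof.
move=> subE; apply/submoduleP; split.
- by exists 0%N, (fun=> 0), (fun=> 0); split=> [[]|[]|] //; rewrite big_ord0.
- move=> _ _ [n [e [f [Ee Ff ->]]]] [m [e' [f' [Ee' Ff' ->]]]].
  exists (n + m)%N.
  exists (fun i => match split i with inl j => e j | inr j => - e' j end).
  exists (fun i => match split i with inl j => f j | inr j => f' j end).
  split=> [i|i|]; do ?[by case: (split i) => // j; exact: submoduleN].
  rewrite big_split_ord -sumrN; congr (_ + _); apply: eq_bigr => i _.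
    by rewrite -[lshift _ _]/(unsplit (inl i)) unsplitK.
  by rewrite -[rshift _ _]/(unsplit (inr i)) unsplitK mulNr.
- move=> a _ [n [e [f [Ee Ff ->]]]]; exists n, (fun i => a%:F * e i), f.
  split=> // [i|]; first exact: submoduleZ.
  by rewrite mulr_sumr; apply: eq_bigr => i _; rewrite mulrA.
Qed.

Lemma sub_mul_overring E T : overring T -> E `<=` mul_submodule E T.
Proof.
move=> oT x Ex; rewrite -[x]mulr1.
by apply: mul_submodule_mul => //; apply: overring1.
Qed.

Lemma mul_submoduleMr E T x t :
  submodule E -> overring T -> T t -> mul_submodule E T x ->
  mul_submodule E T (t * x).
Proof.
move=> subE oT Tt; have subET := mul_submodule_is_submodule T subE.
apply: (@mul_submodule_ind (fun z => mul_submodule E T (t * z)))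
  => [|u v|e f Ee Tf].
- by rewrite mulr0; apply: submodule0.
- by rewrite mulrDr; apply: submoduleD.
- by rewrite mulrCA; apply: mul_submodule_mul => //; apply: overringM.
Qed.

Lemma mul_ideal_overring_sub J T :
  ideal J -> overring T -> mul_submodule J T `<=` T.
Proof.
move=> [_ JD] oT; apply: mul_submodule_sub; first exact: overring_submodule.
by move=> _ f /JD[a _ <-] Tf; apply: overringM => //; apply: overring_base.
Qed.

(** * Valuation overrings over a proper ideal *)

Definition adjoin T (x : K) : set K :=
  [set z | exists2 p : {poly K}, (forall i, T p`_i) & z = p.[x]].

Lemma adjoin_overring T x : overring T -> overring (adjoin T x).
Proof.
move=> oT; have subT := overring_submodule oT.
apply/overringP; split=> [a|_ _ [p Tp ->] [q Tq ->]|_ _ [p Tp ->] [q Tq ->]].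
- exists a%:F%:P; last by rewrite hornerC.
  move=> i; rewrite coefC; case: ifP => _; first exact: overring_base.
  exact: submodule0.
- exists (p - q); last by rewrite hornerD hornerN.
  by move=> i; rewrite coefB; apply: submoduleB.
- exists (p * q); last by rewrite hornerM.
  by move=> i; rewrite coefM; apply: submodule_sum => // j _; apply: overringM.
Qed.

Lemma sub_adjoin T x : overring T -> T `<=` adjoin T x.
Proof.
move=> oT t Tt; exists t%:P; last by rewrite hornerC.
move=> i; rewrite coefC; case: ifP => _ //.
exact: submodule0 (overring_submodule oT).
Qed.

Lemma adjoin_gen T x : overring T -> adjoin T x x.
Proof.
move=> oT; exists 'X; last by rewrite hornerX.
move=> i; rewrite coefX; case: (i == 1%N); first exact: overring1.
exact: submodule0 (overring_submodule oT).
Qed.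

Lemma mul_adjoin J T x z :
  submodule J -> mul_submodule J (adjoin T x) z ->
  exists2 p : {poly K}, (forall i, mul_submodule J T p`_i) & z = p.[x].
Proof.
move=> subJ; have subJT := mul_submodule_is_submodule T subJ.
pose P y :=
  exists2 p : {poly K}, (forall i, mul_submodule J T p`_i) & y = p.[x].
apply: (@mul_submodule_ind P).
- by exists 0; rewrite ?horner0 // => i; rewrite coef0; apply: submodule0.
- move=> _ _ [p Ip ->] [q Iq ->]; exists (p + q); last by rewrite hornerD.
  by move=> i; rewrite coefD; apply: submoduleD.
- move=> e _ Je [p Tp ->]; exists (e *: p); last by rewrite hornerZ.
  by move=> i; rewrite coefZ; apply: mul_submodule_mul.
Qed.

(** The descent behind the existence of valuation overrings.  By symmetry in
    [x] and [x^-1] one may assume that [q] is at most as long as [p].  In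
    [1 = (1 - q_0) p(x) + q_0] the leading term of [p] carries the factor
    [1 - q_0], and [(1 - q_0) x^m] is the sum of the [q_j x^(m - j)] over
    [j > 0]; this leaves a shorter relation for [x] with coefficients in [I].
    Constant relations are excluded as [1] is not in [I]. *)
Lemma no_two_relations T I x (p q : {poly K}) :
  overring T -> submodule I -> I `<=` T ->
  (forall t z, T t -> I z -> I (t * z)) -> ~ I 1 -> x != 0 ->
  (forall i, I p`_i) -> (forall i, I q`_i) ->
  p.[x] = 1 -> q.[x^-1] = 1 -> False.
Proof.
move=> oT subI IT ITM I1; have [n] := ubnP (size p + size q)%N.
elim: n x p q => [//|n IHn] x p q pqn x0 Ip Iq px qx; move: pqn.
wlog qp : x p q x0 Ip Iq px qx / (size q <= size p)%N.
  move=> W; have /orP[qp|pq] := leq_total (size q) (size p).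
    exact: (W x p q).
  by rewrite addnC; apply: (W x^-1 q p); rewrite ?invr_eq0 ?invrK.
move=> pqn.
case sp: (size p) qp => [|m] qp.
  move/eqP: sp; rewrite size_poly_eq0 => /eqP p0.
  by move: px (oner_neq0 K); rewrite p0 horner0 => <-; rewrite eqxx.
have T1 := overring1 oT; have subT := overring_submodule oT.
have [m0|m_gt0] := posnP m.
  have p0 : p = (p`_0)%:P by apply: size1_polyC; rewrite sp m0.
  by apply: I1; rewrite -px p0 hornerC.
pose p' : {poly K} :=
  \poly_(i < m) ((1 - q`_0) * p`_i + p`_m * q`_(m - i)) + (q`_0)%:P.
have Ip' i : I p'`_i.
  rewrite coefD; apply: submoduleD => //; last first.
    by rewrite coefC; case: ifP => _ //; apply: submodule0.
  rewrite coef_poly; case: ifP => _; last exact: submodule0.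
  apply: submoduleD => //; apply: ITM => //; last exact: IT.
  by apply: submoduleB => //; apply: IT.
apply: (IHn x p' q) => //.
  rewrite sp addSn ltnS in pqn; apply: leq_ltn_trans pqn; rewrite leq_add2r.
  rewrite (leq_trans (size_polyD _ _)) // geq_max size_poly.
  exact: leq_trans (size_polyC_leq1 _) m_gt0.
have xV i : (i <= m)%N -> x ^+ i = x ^+ m * x^-1 ^+ (m - i).
  move=> im; rewrite -{1}(subnKC im) exprD -mulrA -exprMn mulfV // expr1n.
  by rewrite mulr1.
rewrite hornerD hornerC horner_poly.
have -> : \sum_(i < m) ((1 - q`_0) * p`_i + p`_m * q`_(m - i)) * x ^+ i =
  (1 - q`_0) * \sum_(i < m) p`_i * x ^+ i
  + p`_m * \sum_(i < m) q`_(m - i) * x ^+ i.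
  rewrite !mulr_sumr -big_split /=; apply: eq_bigr => i _.
  by rewrite mulrDl !mulrA.
have pE : 1 = \sum_(i < m) p`_i * x ^+ i + p`_m * x ^+ m.
  by rewrite -px {1}(horner_coef p) sp big_ord_recr.
have qE : x ^+ m = \sum_(i < m) q`_(m - i) * x ^+ i + q`_0 * x ^+ m.
  rewrite -[LHS]mulr1 -qx (horner_coef_wide _ qp) mulr_sumr.
  rewrite (reindex_inj rev_ord_inj) big_ord_recr /= subnn.
  rewrite expr0 mulr1 mulrC; congr (_ + _); apply: eq_bigr => i _.
  rewrite subSS mulrCA; congr (_ * _); rewrite (xV i) //; exact: ltnW.
move: pE qE; set s := \sum_(i < m) _; set u := \sum_(i < m) _.
move=> pE qE; have -> : u = x ^+ m - q`_0 * x ^+ m.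
  exact: canRL (addrK _) (esym qE).
have -> : s = 1 - p`_m * x ^+ m by exact: canRL (addrK _) (esym pE).
ring.
Qed.

(** A maximal overring [V] with [1] outside [J V] is a valuation ring: if
    neither [x] nor [x^-1] were in [V], maximality would put [1] into both
    [J V[x]] and [J V[x^-1]], against [no_two_relations]. *)
Theorem valuation_above J :
  ideal J -> ~ J 1 -> exists2 V, valuation_overring V & ~ mul_submodule J V 1.
Proof.
move=> iJ J1; have [subJ JD] := iJ.
pose C : set (set K) := [set T | overring T /\ ~ mul_submodule J T 1].
have [||V [[oV V1] _ Vmax]] := @Zorn_above K C (base_ring D).
- split; first exact: base_overring.
  move=> J1'; apply: J1; move: J1'; apply: mul_submodule_sub => //.
  by move=> e _ Je [a _ <-]; rewrite mulrC; apply: submoduleZ.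
- move=> F F0 FC Ftot; split.
    have two x y : (\bigcup_(X in F) X) x -> (\bigcup_(X in F) X) y ->
        exists2 X, F X & X x /\ X y.
      move=> [X FX Xx] [Y FY Yy]; have [XY|YX] := Ftot _ _ FX FY.
        by exists Y => //; split=> //; apply: XY.
      by exists X => //; split=> //; apply: YX.
    apply/overringP; split=> [a|x y Ux Uy|x y Ux Uy].
    + have [X FX] := F0; exists X => //.
      by apply: overring_base; case: (FC _ FX).
    + have [X FX [Xx Xy]] := two _ _ Ux Uy; exists X => //.
      by have [/overring_submodule oX _] := FC _ FX; apply: submoduleB.
    + have [X FX [Xx Xy]] := two _ _ Ux Uy; exists X => //.
      by have [oX _] := FC _ FX; apply: overringM.
  move=> [n [e [f [Je Uf E1]]]].
  have [X FX Xf] := finite_family_in_chain F0 Ftot Uf.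
  by have [_] := FC _ FX; apply; exists n, e, f.
exists V => //; split=> // x x0; apply: contrapT => /not_orP[Vx VxV].
have subJV := mul_submodule_is_submodule V subJ.
have rel y : ~ V y ->
    exists2 p : {poly K}, (forall i, mul_submodule J V p`_i) & p.[y] = 1.
  move=> Vy; have [p Ip p1] : exists2 p : {poly K},
      (forall i, mul_submodule J V p`_i) & 1 = p.[y]; last by exists p.
  apply: mul_adjoin => //; apply: contrapT => Jy.
  have oVy := adjoin_overring y oV.
  have VE : adjoin V y = V by apply: Vmax; [split|apply: sub_adjoin].
  by apply: Vy; rewrite -VE; apply: adjoin_gen.
have [p Ip px] := rel _ Vx; have [q Iq qx] := rel _ VxV.
apply: (@no_two_relations V (mul_submodule J V) x p q) => //.
  exact: mul_ideal_overring_sub.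
by move=> t z Vt; apply: mul_submoduleMr.
Qed.

(** * Prime ideals and localizations *)

Definition residual E (x : K) : set K := [set d | base_ring D d /\ E (d * x)].

Lemma residual_ideal E x : submodule E -> ideal (residual E x).
Proof.
move=> subE; have subD := overring_submodule base_overring.
split; last by move=> d [].
apply/submoduleP; split=> [|d d' [Dd Ed] [Dd' Ed']|a d [Dd Ed]].
- by split; rewrite ?mul0r; apply: submodule0.
- by split; rewrite ?mulrBl; apply: submoduleB.
- by split; rewrite -?mulrA; apply: submoduleZ.
Qed.

Lemma residual_neq0 E x :
  submodule E -> E != [set 0] -> residual E x != [set 0].
Proof.
move=> subE /(submodule_neq0P subE)[e Ee e0].
have [a [b [b0 xeE]]] := fracP (x / e).
apply: (@submodule_neq0 _ b%:F); last by rewrite tofrac_eq0.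
split; first by exists b.
have -> : b%:F * x = a%:F * e.
  rewrite -[x](divfK e0) xeE mulrA mulrCA divff ?tofrac_eq0 // mulr1 //.
exact: submoduleZ.
Qed.

Definition prime_ideal Q : Prop :=
  [/\ ideal Q, ~ Q 1
    & forall a b : D, Q (a * b)%:F -> Q a%:F \/ Q b%:F].

(** The common source of primality for maximal and for t-maximal ideals: the
    residuals [(Q : b)] with [b] outside [Q] are again proper ideals of the
    same kind that contain [Q], so that maximality collapses them to [Q]. *)
Lemma prime_of_residual Q :
  ideal Q -> ~ Q 1 ->
  (forall b : D, ~ Q b%:F -> residual Q b%:F `<=` Q) -> prime_ideal Q.
Proof.
move=> iQ Q1 Qres; split=> // a b Qab.
have [Qb|nQb] := pselect (Q b%:F); [by right|left].
by apply: (Qres b nQb); split; [exists a|rewrite -tofracM].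
Qed.

Lemma sub_residual Q b : ideal Q -> Q `<=` residual Q b%:F.
Proof.
move=> [subQ QD] x Qx; split; first exact: QD.
by rewrite mulrC; apply: submoduleZ.
Qed.

Lemma residualN1 Q b : ~ Q b%:F -> ~ residual Q b%:F 1.
Proof. by move=> Qb [_]; rewrite mul1r. Qed.

Lemma prime_neq0 Q s : prime_ideal Q -> ~ Q s%:F -> s%:F != 0.
Proof.
move=> [[subQ _] _ _] Qs; apply/eqP=> s0.
by apply: Qs; rewrite s0; apply: submodule0.
Qed.

Lemma primeM Q s r :
  prime_ideal Q -> ~ Q s%:F -> ~ Q r%:F -> ~ Q (s * r)%:F.
Proof. by move=> [_ _ QM] Qs Qr /QM[]. Qed.

Lemma localization_overring Q : prime_ideal Q -> overring (localization Q).
Proof.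
move=> pQ; have [_ Q1 _] := pQ; apply/overringP; split=> [a|x y|x y].
- by exists a, 1; rewrite tofrac1 divr1.
- move=> [a [s [Qs ->]]] [b [r [Qr ->]]].
  exists (a * r - b * s), (s * r); split; first exact: primeM.
  by rewrite tofracB !tofracM -mulNr addf_div ?mulNr //; apply: prime_neq0 pQ _.
- move=> [a [s [Qs ->]]] [b [r [Qr ->]]].
  exists (a * b), (s * r); split; first exact: primeM.
  by rewrite !tofracM mulf_div.
Qed.

Lemma mem_localization Q s x :
  prime_ideal Q -> ~ Q s%:F -> base_ring D (s%:F * x) -> localization Q x.
Proof.
move=> pQ Qs [a _ ax]; exists a, s; split=> //.
by rewrite ax mulrAC divff ?mul1r //; apply: prime_neq0 pQ _.
Qed.

Lemma clear_denominator Q E x :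
  prime_ideal Q -> submodule E -> mul_submodule E (localization Q) x ->
  exists2 s, ~ Q s%:F & E (s%:F * x).
Proof.
move=> pQ subE.
apply: (@mul_submodule_ind (fun z => exists2 s, ~ Q s%:F & E (s%:F * z))).
- exists 1; first by rewrite tofrac1; case: pQ.
  by rewrite mulr0; apply: submodule0.
- move=> y z [s Qs Ey] [r Qr Ez]; exists (s * r); first exact: primeM.
  rewrite tofracM mulrDr; apply: submoduleD => //.
    by rewrite mulrAC mulrC; apply: submoduleZ.
  by rewrite -mulrA; apply: submoduleZ.
- move=> e _ Ee [a [s [Qs ->]]]; exists s => //.
  rewrite mulrCA [_ * (_ / _)]mulrC divfK; last exact: prime_neq0 pQ _.
  by rewrite mulrC; apply: submoduleZ.
Qed.

Lemma common_denominator Q n (x : 'I_n -> K) :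
  prime_ideal Q -> (forall i, localization Q (x i)) ->
  exists2 s, ~ Q s%:F & forall i, base_ring D (s%:F * x i).
Proof.
move=> pQ; have subD := overring_submodule base_overring.
elim: n x => [|n IHn] x Qx.
  by exists 1; [rewrite tofrac1; case: pQ|case].
have [s Qs sx] := IHn (fun i => x (lift ord0 i)) (fun i => Qx _).
have [a [r [Qr xE]]] := Qx ord0; exists (s * r); first exact: primeM.
move=> i; rewrite tofracM; case: (unliftP ord0 i) => [j|] ->.
  by rewrite mulrAC mulrC; apply: submoduleZ.
exists (s * a) => //; rewrite xE tofracM -mulrA; congr (_ * _).
by rewrite mulrC divfK //; apply: prime_neq0 pQ _.
Qed.

(** The localization at the zero ideal is the whole of [K], which makes
    [common_denominator] applicable to arbitrary finite families. *)
Lemma prime0 : prime_ideal ([set 0] : set K).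
Proof.
split=> [||a b /eqP].
- split; last by move=> _ ->; exists 0; rewrite ?tofrac0.
  apply/submoduleP; split=> // [x y -> ->|a x ->] /=; first by rewrite subr0.
  by rewrite mulr0.
- by apply/eqP; exact: oner_neq0.
- rewrite tofrac_eq0 mulf_eq0.
  by move=> /orP[]/eqP ->; rewrite tofrac0; [left|right].
Qed.

Lemma localization0 (x : K) : localization ([set 0] : set K) x.
Proof.
have [a [b [b0 ->]]] := fracP x; exists a, b; split=> //.
by apply/eqP; rewrite tofrac_eq0.
Qed.

Lemma sub_prime J Q :
  ideal J -> prime_ideal Q -> ~ mul_submodule J (localization Q) 1 -> J `<=` Q.
Proof.
move=> [subJ JD] pQ J1 x Jx; have [a _ xE] := JD _ Jx.
apply: contrapT => Qx; apply: J1; rewrite -xE in Jx Qx.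
rewrite -(divff (prime_neq0 pQ Qx)).
apply: mul_submodule_mul => //; exists 1, a; split=> //.
by rewrite tofrac1 mul1r.
Qed.

Lemma maximal_ideal_above J :
  ideal J -> ~ J 1 ->
  exists M, [/\ ideal M, ~ M 1, J `<=` M
    & forall N, ideal N -> ~ N 1 -> M `<=` N -> N = M].
Proof.
move=> iJ J1; pose C : set (set K) := [set I | ideal I /\ ~ I 1].
have [||M [[iM M1] JM Mmax]] := @Zorn_above K C J.
- by [].
- move=> F F0 FC Ftot; split; last by move=> [X FX]; case: (FC _ FX).
  split; last by move=> x [X /FC[[_ XD] _]]; apply: XD.
  apply/submoduleP; split=> [|x y [X FX Xx] [Y FY Yy]|a x [X FX Xx]].
  + have [X FX] := F0; exists X => //.
    by have [[subX _] _] := FC _ FX; apply: submodule0.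
  + have [XY|YX] := Ftot _ _ FX FY.
      exists Y => //; have [[subY _] _] := FC _ FY.
      by apply: submoduleB => //; apply: XY.
    exists X => //; have [[subX _] _] := FC _ FX.
    by apply: submoduleB => //; apply: YX.
  + exists X => //; have [[subX _] _] := FC _ FX; exact: submoduleZ.
- by exists M; split=> // N iN N1 MN; apply: Mmax.
Qed.

Lemma maximal_prime M :
  ideal M -> ~ M 1 -> (forall N, ideal N -> ~ N 1 -> M `<=` N -> N = M) ->
  prime_ideal M.
Proof.
move=> iM M1 Mmax; apply: prime_of_residual => // b Mb.
rewrite (Mmax (residual M b%:F)) //; last exact: sub_residual.
  by apply: residual_ideal; case: iM.
exact: residualN1.
Qed.

(** * The t-operation *)

Definition span n (g : 'I_n -> K) : set K :=
  [set x | exists c : 'I_n -> D, x = \sum_i (c i)%:F * g i].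

Lemma span_submodule n (g : 'I_n -> K) : submodule (span g).
Proof.
apply/submoduleP; split=> [|_ _ [c ->] [c' ->]|a _ [c ->]].
- by exists (fun=> 0); rewrite big1 // => i _; rewrite tofrac0 mul0r.
- exists (fun i => c i - c' i); rewrite -sumrB.
  by apply: eq_bigr => i _; rewrite tofracB mulrBl.
- exists (fun i => a * c i); rewrite mulr_sumr.
  by apply: eq_bigr => i _; rewrite tofracM mulrA.
Qed.

Lemma span_gen n (g : 'I_n -> K) i : span g (g i).
Proof.
exists (fun j => (i == j)%:R); rewrite (bigD1 i) //= eqxx tofrac1 mul1r.
rewrite big1 ?addr0 // => j; rewrite eq_sym => /negbTE ->.
by rewrite tofrac0 mul0r.
Qed.

Lemma span_sub n (g : 'I_n -> K) E :
  submodule E -> (forall i, E (g i)) -> span g `<=` E.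
Proof.
by move=> subE Eg _ [c ->]; apply: submodule_sum => // i _; apply: submoduleZ.
Qed.

Lemma ideal_fractional I : ideal I -> fractional_ideal I.
Proof.
move=> [subI ID]; split=> //; exists 1; first exact: oner_neq0.
by move=> x /ID; rewrite tofrac1 mul1r.
Qed.

Lemma sub_semistar_v E : E `<=` semistar_v D E.
Proof. by move=> x Ex y; rewrite mulrC; apply. Qed.

Lemma sub_semistar_t I : ideal I -> I != [set 0] -> I `<=` semistar_t D I.
Proof.
move=> iI; have [subI ID] := iI => /(submodule_neq0P subI)[z0 Iz0 z00] x Ix.
(* A principal submodule has to be nonzero to count in the t-closure; when
   x is 0, some other nonzero element of I takes its place. *)
have [z [Iz z_neq0 zx]] : exists z, [/\ I z, z != 0 & x = 0 \/ x = z].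
  by have [->|x0] := eqVneq x 0; [exists z0|exists x]; split=> //; [left|right].
pose F := span (fun _ : 'I_1 => z).
have FI : F `<=` I by apply: span_sub.
have Fz : F z := span_gen (fun _ : 'I_1 => z) ord0.
have subF : submodule F := span_submodule _.
exists F; last first.
  by apply: sub_semistar_v; case: zx => ->; first exact: submodule0.
split=> //; first exact: submodule_neq0 Fz _.
  by exists 1%N, (fun=> z).
apply: ideal_fractional; split=> //; exact: subset_trans ID.
Qed.

(** If [x] is in the v-closure of a finitely generated [F] inside [(Q : b)],
    then [x b] is in the v-closure of [b F], which lies in [Q^t = Q].  So
    [(Q : b)] is a t-ideal, and [prime_of_residual] applies. *)
Lemma t_maximal_prime Q : t_maximal Q -> prime_ideal Q.
Proof.
move=> [[iQ QD Q0 Qt] Qmax]; have [subQ QsubD] := iQ.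
have Q1 : ~ Q 1 by apply/idealN1P.
apply: prime_of_residual => // b Qb.
have b0 : b%:F != 0.
  by apply/eqP=> b0; apply: Qb; rewrite b0; apply: submodule0.
have iR := residual_ideal b%:F subQ.
have R0 : residual Q b%:F != [set 0].
  have [x Qx x0] := submodule_neq0P subQ Q0.
  by apply: submodule_neq0 x0; apply: sub_residual.
suff tR : semistar_t D (residual Q b%:F) = residual Q b%:F.
  rewrite (Qmax (residual Q b%:F)) //; last exact: sub_residual.
  by split=> //; apply/idealN1P => //; apply: residualN1.
apply/seteqP; split; last exact: sub_semistar_t.
move=> x [F [FR F0 [n [g FE]] fF] Fx]; split.
  by rewrite -[x]mulr1; apply: Fx => y /FR[Dy _]; rewrite mul1r.
have Fg i : F (g i) by rewrite FE; apply: span_gen.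
pose G := span (fun i => g i * b%:F).
have GQ : G `<=` Q by apply: span_sub => // i; have [] := FR _ (Fg i).
have GF y : F y -> G (y * b%:F).
  rewrite FE => -[c ->]; exists c; rewrite mulr_suml.
  by apply: eq_bigr => i _; rewrite mulrA.
rewrite -Qt; exists G.
  split=> //; [|by exists n, (fun i => g i * b%:F)|].
    have [y Fy y0] := submodule_neq0P fF.1 F0.
    by apply: submodule_neq0 (GF _ Fy) _; rewrite mulf_neq0.
  apply: ideal_fractional; split; first exact: span_submodule.
  exact: subset_trans QsubD.
move=> y Gy; rewrite -mulrA [_ * y]mulrC; apply: Fx => z Fz.
by rewrite -mulrA [_ * z]mulrC; apply/Gy/GF.
Qed.

(** * Invertibility from valuation localizations *)

Lemma valuation_min V n (g : 'I_n -> K) :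
  valuation_overring V -> (exists i, g i != 0) ->
  exists2 i, g i != 0 & forall j, V (g j / g i).
Proof.
move=> [oV Vval]; have V1 := overring1 oV.
have V0 : V 0 := submodule0 (overring_submodule oV).
elim: n g => [|n IHn] g; first by move=> [[]].
case: (pselect (exists i, g (lift ord0 i) != 0)) => [nz _|z [i gi]]; last first.
  have z' j : g (lift ord0 j) = 0.
    by apply/eqP/contraT => gj; case: z; exists j.
  exists ord0 => [|j].
    by move: gi; case: (unliftP ord0 i) => [j|] -> //; rewrite z' eqxx.
  case: (unliftP ord0 j) => [k|] ->; first by rewrite z' mul0r.
  have [->|g0] := eqVneq (g ord0) 0; first by rewrite mul0r.
  by rewrite divff.
have [i gi Vg] := IHn (fun i => g (lift ord0 i)) nz.
have [g0|g0] := eqVneq (g ord0) 0.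
  exists (lift ord0 i) => // j; case: (unliftP ord0 j) => [k|] -> //.
  by rewrite g0 mul0r.
have [|V0i|Vi0] := Vval (g ord0 / g (lift ord0 i)).
    by rewrite mulf_neq0 ?invr_neq0.
  by exists (lift ord0 i) => // j; case: (unliftP ord0 j) => [k|] ->.
exists ord0 => // j; case: (unliftP ord0 j) => [k|] ->; last by rewrite divff.
rewrite invf_div in Vi0.
rewrite -[g (lift ord0 k)](divfK gi) -[X in V X]mulrA.
exact: (overringM oV (Vg k) Vi0).
Qed.

(** If [J = F (D : F)] were proper, take [Q] over [J].  A generator [g] of
    least value generates [F D_Q], so a common denominator [s] outside [Q]
    gives [s / g] in [(D : F)], and [s = g (s / g)] is in [J] but not in [Q]. *)
Lemma invertible_of_local F :
  ideal F -> F != [set 0] -> finitely_generated F ->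
  (forall J, ideal J -> J != [set 0] -> ~ J 1 ->
     exists Q, [/\ prime_ideal Q, J `<=` Q
                  & valuation_overring (localization Q)]) ->
  invertible_ideal F.
Proof.
move=> [subF FD] F0 [n [g FE]] loc.
have Fg i : F (g i) by rewrite FE; apply: span_gen.
have subJ := mul_submodule_is_submodule (colon F) subF.
have subD := overring_submodule base_overring.
have iJ : ideal (mul_submodule F (colon F)).
  split=> //; apply: mul_submodule_sub => // f h Ff Fh.
  by rewrite mulrC; apply: Fh.
apply: contrapT => /eqP /(idealN1P iJ) J1.
have [|Q [pQ JQ vQ]] := loc _ iJ _ J1.
  have [x Fx x0] := submodule_neq0P subF F0; apply: submodule_neq0 x0.
  by rewrite -[x]mulr1; apply: mul_submodule_mul => // y /FD; rewrite mul1r.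
have [|i gi Vg] := @valuation_min _ _ g vQ.
  apply: contrapT => g0; move/eqP: F0; apply; apply/seteqP; split; last first.
    by move=> _ ->; apply: submodule0.
  rewrite FE => _ [c ->]; apply: big1 => i _.
  suff -> : g i = 0 by rewrite mulr0.
  by apply/eqP/contraT => gi; case: g0; exists i.
have [s Qs sg] := common_denominator pQ Vg.
apply: Qs; apply: JQ; rewrite -[s%:F](divfK gi) mulrC.
apply: mul_submodule_mul => //.
suff : F `<=` residual (base_ring D) (s%:F / g i).
  by move=> sF y /sF[_]; rewrite mulrC.
rewrite FE; apply: span_sub; first by case: (residual_ideal (s%:F / g i) subD).
by move=> j; split; [apply: FD|rewrite mulrCA; apply: sg].
Qed.

Definition quad (x : K) : set K :=
  [set z | exists u v : D, z = u%:F + v%:F * x ^+ 2].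

Lemma quad_nonzero_submodule x : nonzero_submodule (quad x).
Proof.
split; last first.
  apply: submodule_neq0 (oner_neq0 K).
  by exists 1, 0; rewrite tofrac1 tofrac0 mul0r addr0.
apply/submoduleP; split=> [|_ _ [u [v ->]] [u' [v' ->]]|a _ [u [v ->]]].
- by exists 0, 0; rewrite !tofrac0 mul0r addr0.
- by exists (u - u'), (v - v'); rewrite !tofracB; ring.
- by exists (a * u), (a * v); rewrite !tofracM; ring.
Qed.

Lemma mem_quad_b x : semistar_b D (quad x) x.
Proof.
move=> V [oV Vval].
have [->|x0] := eqVneq x 0.
  apply: submodule0.
  exact: mul_submodule_is_submodule (quad_nonzero_submodule 0).1.
have [Vx|Vx] := Vval x x0.
  suff : mul_submodule (quad x) V (1 * x) by rewrite mul1r.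
  apply: mul_submodule_mul => //.
  by exists 1, 0; rewrite tofrac1 tofrac0 mul0r addr0.
suff : mul_submodule (quad x) V (x ^+ 2 * x^-1) by rewrite expr2 mulfK.
apply: mul_submodule_mul => //.
by exists 0, 1; rewrite tofrac1 tofrac0 mul1r add0r.
Qed.

(** With [y = v x], the equation [s x = u + v x^2] becomes
    [y^2 = s y - u v], so [y] is in every valuation overring: either directly,
    or because [y = s - u v y^-1].  Hence [y] is in [D_Q], where [y] or
    [s - y] is a unit; the inverse of [x] is [v / y], and [x] is
    [u / (s - y)]. *)
Lemma localization_valuation Q :
  prime_ideal Q -> semistar_b D (localization Q) `<=` localization Q ->
  (forall x, exists s u v : D,
     ~ Q s%:F /\ s%:F * x = u%:F + v%:F * x ^+ 2) ->
  valuation_overring (localization Q).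
Proof.
move=> pQ Qb quadQ; have oQ := localization_overring pQ.
have [[subQ _] _ _] := pQ.
split=> // x x0; have [s [u [v [Qs sx]]]] := quadQ x.
set y := v%:F * x; have yE : y ^+ 2 = s%:F * y - u%:F * v%:F.
  by rewrite /y [s%:F * _]mulrCA sx; ring.
have [c [q [Qq yq]]] : localization Q y.
  apply: Qb => W [oW Wval]; rewrite -[y]mul1r.
  apply: mul_submodule_mul; first exact: overring1.
  have [->|y0] := eqVneq y 0; first exact: submodule0 (overring_submodule oW).
  have [//|Wy] := Wval y y0.
  have -> : y = s%:F - (u * v)%:F * y^-1.
    by apply: (mulIf y0); rewrite mulrBl mulfVK // -expr2 yE tofracM.
  apply: submoduleB; first exact: overring_submodule.
    exact: overring_base.
  by apply: overringM => //; apply: overring_base.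
have q0 := prime_neq0 pQ Qq.
have c_y : c%:F = q%:F * y by rewrite yq mulrC divfK.
have [Qc|Qc] := pselect (Q c%:F); [left|right].
  apply: (@mem_localization _ (s * q - c)) => //.
    rewrite tofracB => Qsc; apply: (primeM pQ Qs Qq).
    by rewrite -[X in Q X](subrK c%:F); apply: submoduleD.
  exists (q * u) => //; rewrite tofracB !tofracM c_y /y.
  have -> : u%:F = s%:F * x - v%:F * x ^+ 2 by rewrite sx addrK.
  ring.
apply: (@mem_localization _ c) => //; exists (q * v) => //.
by rewrite c_y /y tofracM mulrA mulfK.
Qed.

(** * The implications *)

Lemma Prufer_of_b_eq_w :
  semistar_eq (semistar_b D) (semistar_w D) -> Prufer_domain D.
Proof.
move=> bw F iF F0 fgF; apply: invertible_of_local => // J iJ J0 J1.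
have [Q tQ JQ1] : exists2 Q, t_maximal Q & ~ mul_submodule J (localization Q) 1.
  apply: contrapT => nQ; have [V vV JV1] := valuation_above iJ J1.
  suff : semistar_b D J 1 by move=> /(_ V vV).
  rewrite bw; last by case: iJ.
  by move=> Q tQ; apply: contrapT => JQ; apply: nQ; exists Q.
have pQ := t_maximal_prime tQ; have oQ := localization_overring pQ.
exists Q; split=> //; first exact: sub_prime.
apply: localization_valuation => //.
  rewrite bw => [x /(_ Q tQ)|].
    apply: mul_submodule_sub; first exact: overring_submodule.
    by move=> e f; apply: overringM.
  split; first exact: overring_submodule.
  exact: submodule_neq0 (overring1 oQ) (oner_neq0 _).
move=> x; have := mem_quad_b x; rewrite bw; last exact: quad_nonzero_submodule.
move=> /(_ Q tQ) /(clear_denominator pQ (quad_nonzero_submodule x).1).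
move=> [s Qs [u [v sx]]].
by exists s, u, v.
Qed.

Lemma Prufer_of_d_eq_b :
  semistar_eq (semistar_d D) (semistar_b D) -> Prufer_domain D.
Proof.
move=> db F iF F0 fgF; apply: invertible_of_local => // J iJ J0 J1.
have [M [iM M1 JM Mmax]] := maximal_ideal_above iJ J1.
have pM := maximal_prime iM M1 Mmax; have oM := localization_overring pM.
exists M; split=> //; apply: localization_valuation => //.
  rewrite -db //; split; first exact: overring_submodule.
  exact: submodule_neq0 (overring1 oM) (oner_neq0 _).
move=> x; have := mem_quad_b x; rewrite -db; last exact: quad_nonzero_submodule.
by move=> [u [v xE]]; exists 1, u, v; rewrite tofrac1 mul1r.
Qed.

Lemma d_eq_b_of_Prufer :
  Prufer_domain D -> semistar_eq (semistar_d D) (semistar_b D).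
Proof.
move=> prD E [subE E0]; apply/seteqP; split.
  by move=> x Ex V [oV _]; apply: sub_mul_overring.
move=> x Ebx; apply: contrapT => Ex.
have iI := residual_ideal x subE; set I := residual E x in iI.
have I1 : ~ I 1 by move=> [_]; rewrite mul1r.
have [V vV IV1] := valuation_above iI I1; have [oV _] := vV.
have [n [e [f [Ee Vf xE]]]] := Ebx V vV.
have [d d0 df] := common_denominator prime0 (fun i => localization0 (f i)).
have {}d0 : d%:F != 0 by apply/eqP.
(* The generators 1, f_1, .., f_n, scaled into D by d. *)
pose g (i : 'I_n.+1) := d%:F * (if unlift ord0 i is Some j then f j else 1).
have gl i : g (lift ord0 i) = d%:F * f i by rewrite /g liftK.
have g0 : g ord0 = d%:F by rewrite /g unlift_none mulr1.
have Fd : span g d%:F by rewrite -[X in _ X]g0; apply: span_gen.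
have Fdf i : span g (d%:F * f i) by rewrite -gl; apply: span_gen.
have subD := overring_submodule base_overring.
have iF : ideal (span g).
  split; first exact: span_submodule.
  apply: span_sub => // i.
  case: (unliftP ord0 i) => [j|] ->; first by rewrite gl.
  by rewrite g0; exists d.
have invF : invertible_ideal (span g).
  apply: prD => //; first exact: submodule_neq0 Fd d0.
  by exists n.+1, g.
apply: IV1; have : mul_submodule (span g) (colon (span g)) 1.
  rewrite invF; exact: overring1 base_overring.
have subI : submodule I by case: iI.
apply: mul_submodule_sub; first exact: mul_submodule_is_submodule.
(* Undo the scaling: a / d is in V, and h d sends 1 and all f_i into D. *)
move=> a h Fa Fh; have -> : a * h = (h * d%:F) * (a / d%:F).
  by rewrite mulrC -mulrA [d%:F * _]mulrC divfK.
apply: mul_submodule_mul.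
  split; first exact: Fh.
  rewrite xE mulr_sumr; apply: submodule_sum => // i _.
  rewrite mulrCA -mulrA; have [b _ <-] := Fh _ (Fdf i).
  by rewrite mulrC; apply: submoduleZ.
case: Fa => c ->; rewrite mulr_suml.
apply: submodule_sum => [|i _]; first exact: overring_submodule.
 rewrite -mulrA; apply: overringM => //; first exact: overring_base.
case: (unliftP ord0 i) => [j|] ->; first by rewrite gl mulrC mulKf.
by rewrite g0 divff //; apply: overring1.
Qed.

(** An invertible [F] satisfies [F^v = F]: for [x] in [F^v], multiplying
    [1 = sum f_i h_i] by [x] gives coefficients [x h_i] in [D]. *)
Lemma Prufer_t_ideal I :
  Prufer_domain D -> ideal I -> I != [set 0] -> semistar_t D I = I.
Proof.
move=> prD iI I0; have [subI ID] := iI.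
apply/seteqP; split; last exact: sub_semistar_t.
move=> x [F [FI F0 fgF [subF _]] Fx].
have iF : ideal F by split=> //; exact: subset_trans ID.
have : mul_submodule F (colon F) 1.
  by rewrite (prD F iF F0 fgF); apply: overring1 base_overring.
move=> F1; apply: FI; rewrite -[x]mulr1.
move: F1; apply: (@mul_submodule_ind (fun z => F (x * z))) => [|y z|f h Ff Fh].
- by rewrite mulr0; apply: submodule0.
- by rewrite mulrDr; apply: submoduleD.
- by have [a _ ah] := Fx _ Fh; rewrite mulrCA -ah mulrC; apply: submoduleZ.
Qed.

Lemma w_of_Prufer E :
  Prufer_domain D -> nonzero_submodule E -> semistar_w D E = E.
Proof.
move=> prD [subE E0]; apply/seteqP; split; last first.
  move=> x Ex Q tQ; apply: sub_mul_overring => //.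
  exact/localization_overring/t_maximal_prime.
move=> x Ewx; apply: contrapT => Ex.
have iI := residual_ideal x subE.
have I1 : ~ residual E x 1 by move=> [_]; rewrite mul1r.
have [M [iM M1 IM Mmax]] := maximal_ideal_above iI I1.
have [subM _] := iM; have pM := maximal_prime iM M1 Mmax.
have M0 : M != [set 0].
  have [y Iy y0] := submodule_neq0P iI.1 (residual_neq0 x subE E0).
  exact: submodule_neq0 (IM _ Iy) y0.
have tM : t_maximal M.
  split; first by split=> //; [apply/idealN1P|apply: Prufer_t_ideal].
  by move=> N [iN ND _ _]; apply: Mmax => //; apply/idealN1P.
have [s Ms Esx] := clear_denominator pM subE (Ewx M tM).
by apply: Ms; apply: IM; split; first by exists s.
Qed.

End Prufer.

Theorem proposition34 (D : idomainType) :
  [<-> semistar_eq (semistar_b D) (semistar_w D);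
       Prufer_domain D;
       semistar_eq (semistar_d D) (semistar_b D)].
Proof.
tfae.
- exact: Prufer_of_b_eq_w.
- exact: d_eq_b_of_Prufer.
- move=> db E nzE; have prD := Prufer_of_d_eq_b db.
  by rewrite -db // w_of_Prufer.
Qed.
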